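(* Let $E=\{(0,2),(0,3),(2,0),(2,2),(2,3),(3,0),(3,2),(3,3)\}$. For each of the following sets $T$, with $R=E\cup T$, we have $(123,R)\sim_d(132,R)$: (1) $T=\{(0,0)\}$; (2) $T=\{(0,1),(1,0)\}$; (3) $T=\{(0,0),(0,1),(1,0)\}$; (4) $T=\{(1,1)\}$; (5) $T=\{(0,0),(1,1)\}$; (6) $T=\{(0,1),(1,0),(1,1)\}$; (7) $T=\{(0,0),(0,1),(1,0),(1,1)\}$.
   Context: $S_n$ denotes the set of permutations of $[n]=\{1,\dots,n\}$, written $\pi=\pi_1\cdots\pi_n$. A mesh pattern of length $k$ is a pair $(\tau,R)$ with $\tau\in S_k$ and $R\subseteq\{0,1,\dots,k\}^2$ (the shaded boxes; box $(a,b)$ is the unit square $[a,a+1]\times[b,b+1]$ in the diagram of $\tau$). An occurrence of $(\tau,R)$ in $\pi\in S_n$ is a choice of indices $i_1<\dots<i_k$ such that $\pi_{i_1}\cdots\pi_{i_k}$ is order-isomorphic to $\tau$ and, with $i_0=0$, $i_{k+1}=n+1$, $v_1<\dots<v_k$ the values $\pi_{i_1},\dots,\pi_{i_k}$ sorted increasingly, $v_0=0$, $v_{k+1}=n+1$, for every $(a,b)\in R$ there is no index $m$ with $i_a<m<i_{a+1}$ and $v_b<\pi_m<v_{b+1}$. Mesh patterns $p,q$ are equidistributed, $p\sim_d q$, if for all $n,\ell\ge0$ the number of $\pi\in S_n$ with exactly $\ell$ occurrences of $p$ equals the number with exactly $\ell$ occurrences of $q$. *)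

(* Defs.v *)
From mathcomp Require Import all_boot all_fingroup.

Set Implicit Arguments.
Unset Strict Implicit.
Unset Printing Implicit Defensive.

(* Permutations of [n] are elements of 'S_n, which act on {0, ..., n-1}:
   the position i and the value j of the usual 1-based notation are the
   ordinals i-1 and j-1. Boxes are indexed by {0, ..., k} as usual. *)
Record mesh_pattern (k : nat) := MeshPattern {
  mp_perm : 'S_k;
  mp_shading : {set 'I_k.+1 * 'I_k.+1}
}.

Definition increasing k n (f : {ffun 'I_k -> 'I_n}) : bool :=
  [forall a : 'I_k, forall b : 'I_k, (a < b) ==> (f a < f b)].

Definition order_isomorphic k n (tau : 'S_k) (pi : 'S_n)
    (f : {ffun 'I_k -> 'I_n}) : bool :=
  [forall a : 'I_k, forall b : 'I_k,
     (tau a < tau b) == (pi (f a) < pi (f b))].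

(* The 1-based sequences i_0, i_1, ..., i_(k+1) and v_0, v_1, ..., v_(k+1),
   with i_0 = v_0 = 0 and i_(k+1) = v_(k+1) = n + 1. *)
Definition positions k n (f : {ffun 'I_k -> 'I_n}) : seq nat :=
  0 :: rcons [seq (f a : nat).+1 | a <- enum 'I_k] n.+1.

Definition values k n (pi : 'S_n) (f : {ffun 'I_k -> 'I_n}) : seq nat :=
  0 :: rcons (sort leq [seq (pi (f a) : nat).+1 | a <- enum 'I_k]) n.+1.

Definition box_empty k n (pi : 'S_n) (f : {ffun 'I_k -> 'I_n})
    (x : 'I_k.+1 * 'I_k.+1) : bool :=
  let i := nth 0 (positions f) in
  let v := nth 0 (values pi f) in
  ~~ [exists m : 'I_n, (i x.1 < m.+1 < i x.1.+1) &&
                       (v x.2 < (pi m : nat).+1 < v x.2.+1)].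

Definition occurrence k n (p : mesh_pattern k) (pi : 'S_n)
    (f : {ffun 'I_k -> 'I_n}) : bool :=
  [&& increasing f, order_isomorphic (mp_perm p) pi f
    & [forall x in mp_shading p, box_empty pi f x]].

Definition occurrences k n (p : mesh_pattern k) (pi : 'S_n) : nat :=
  #|[set f : {ffun 'I_k -> 'I_n} | occurrence p pi f]|.

Definition equidistributed k1 k2
    (p : mesh_pattern k1) (q : mesh_pattern k2) : Prop :=
  forall n l : nat,
    #|[set pi : 'S_n | occurrences p pi == l]| =
    #|[set pi : 'S_n | occurrences q pi == l]|.

Definition boxes k (s : seq (nat * nat)) : {set 'I_k.+1 * 'I_k.+1} :=
  [set x : 'I_k.+1 * 'I_k.+1 | (x.1 : nat, x.2 : nat) \in s].

Definition perm123 : 'S_3 := 1%g.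
Definition perm132 : 'S_3 := tperm (inord 1) (inord 2).

Definition boxesE : seq (nat * nat) :=
  [:: (0, 2); (0, 3); (2, 0); (2, 2); (2, 3); (3, 0); (3, 2); (3, 3)].

(* Main.v *)
(** Shading E forces the last two points of an occurrence, at positions j < c,
    to carry the two largest values found at positions >= j. Such a c is
    determined by j, and the two values are increasing for 123 and decreasing
    for 132. Call [flip j] the involution of S_n that swaps these two values
    when j admits such a c, and is the identity otherwise. It turns the
    occurrences of either pattern whose middle point is at j into occurrences of
    the other one, with the same first point. It leaves unchanged the pairs
    (first point, middle position) of the occurrences with middle position
    different from j, because the two swapped points lie weakly above or weakly
    to the right of the remaining boxes of the pattern, and only these boxes may
    be shaded by T. Composing the flips at all positions gives a bijection of
    S_n that exchanges the two statistics. *)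

Require Import Defs.
From mathcomp Require Import all_boot all_fingroup.
From mathcomp Require Import zify.

Set Implicit Arguments.
Unset Strict Implicit.
Unset Printing Implicit Defensive.

(** * Top pairs, flips, and occurrences recorded by first and middle point *)

Definition top_pair n (pi : 'S_n) (i c : 'I_n) : bool :=
  (i < c) && [forall m : 'I_n, (i < m) ==> (m != c) ==> (pi m < minn (pi i) (pi c))].

Definition flip n (i : 'I_n) (pi : 'S_n) : 'S_n :=
  if [pick c | top_pair pi i c] is Some c then (tperm i c * pi)%g else pi.

(** The grid lines [i], [v] are 1-based with border 0 while [p], [q] are 0-based, hence the
    successors. *)
Definition inside (i v : seq nat) (p q : nat) (x : nat * nat) : bool :=
  (nth 0 i x.1 < p.+1 < nth 0 i x.1.+1) && (nth 0 v x.2 < q.+1 < nth 0 v x.2.+1).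

Definition region_empty n (pi : 'S_n) (i v : seq nat) (x : nat * nat) : bool :=
  ~~ [exists m : 'I_n, inside i v m (pi m) x].

(** The three lines listed in each direction bound all boxes with coordinates below 2; beyond them
    the upper line is the default 0 and the box counts as empty. *)
Definition box_free n (pi : 'S_n) (a j : 'I_n) (y : nat) : pred (nat * nat) :=
  region_empty pi [:: 0; a.+1; j.+1] [:: 0; (pi a).+1; y.+1].

(* The conditions on the first point a of an occurrence with middle position j,
   where y is the smaller value of its last two points; the boxes in T do not
   involve the position or the value of the remaining corner. *)
Definition low_point (T : seq (nat * nat)) n (pi : 'S_n) (a j : 'I_n) (y : nat) : bool :=
  [&& a < j, pi a < y, [forall m : 'I_n, (m < a) ==> (pi m < y)],
      [forall m : 'I_n, (j < m) ==> (pi a < pi m)] & all (box_free pi a j y) T].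

(** [asc] is true for 123 and false for 132, so that a flip can act on it by exclusive or. *)
Definition occurs_at (asc : bool) T n (pi : 'S_n) (a j : 'I_n) : bool :=
  [exists c, [&& top_pair pi j c, (pi j < pi c) == asc &
                 low_point T pi a j (minn (pi j) (pi c))]].

Lemma perm_neq_nat n (pi : 'S_n) (i j : 'I_n) : i != j -> (pi i : nat) != pi j.
Proof. by apply: contra => /eqP /val_inj /perm_inj ->. Qed.

Lemma top_pairP n (pi : 'S_n) (i c : 'I_n) :
  reflect (i < c /\ forall m : 'I_n, i < m -> m != c -> pi m < minn (pi i) (pi c))
          (top_pair pi i c).
Proof.
apply: (iffP andP) => -[lt_ic top]; split => //.
  by move=> m lt_im ne_mc; move/forallP/(_ m): top; rewrite lt_im ne_mc.
by apply/forallP => m; apply/implyP => ?; apply/implyP => ?; apply: top.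
Qed.

(** Of two distinct candidates, each would have to carry a smaller value than the other. *)
Lemma top_pair_uniq n (pi : 'S_n) (i c c' : 'I_n) :
  top_pair pi i c -> top_pair pi i c' -> c = c'.
Proof.
move=> /top_pairP[lt_ic top] /top_pairP[lt_ic' top'].
apply/eqP; apply/negPn/negP => ne.
have := top' c lt_ic ne; have := top c' lt_ic'; rewrite eq_sym ne => /(_ isT).
lia.
Qed.

Lemma top_pair_tperm n (pi : 'S_n) (i c : 'I_n) :
  top_pair pi i c -> top_pair (tperm i c * pi)%g i c.
Proof.
move=> /top_pairP[lt_ic top]; apply/top_pairP; split => // m lt_im ne_mc.
rewrite !permM tpermL tpermR tpermD ?[minn (pi c) _]minnC; first exact: top.
- by apply: contraTneq lt_im => ->; rewrite ltnn.
- by rewrite eq_sym.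
Qed.

Lemma flip_top_pair n (pi : 'S_n) (i c : 'I_n) :
  top_pair pi i c -> flip i pi = (tperm i c * pi)%g.
Proof.
rewrite /flip => ic; case: pickP => [c' ic'|/(_ c)]; last by rewrite ic.
by rewrite (top_pair_uniq ic ic').
Qed.

Lemma flipK n (i : 'I_n) : involutive (flip i).
Proof.
move=> pi; case: (pickP (top_pair pi i)) => [c ic|no].
  by rewrite (flip_top_pair ic) (flip_top_pair (top_pair_tperm ic)) mulgA tperm2 mul1g.
have E : flip i pi = pi by rewrite /flip; case: pickP => // c; rewrite no.
by rewrite !E.
Qed.

(** * Effect of a single flip on occurrences *)

Lemma low_pointP T n (pi : 'S_n) (a j : 'I_n) y :
  reflect [/\ a < j, pi a < y, forall m : 'I_n, m < a -> pi m < y,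
              forall m : 'I_n, j < m -> pi a < pi m & all (box_free pi a j y) T]
          (low_point T pi a j y).
Proof.
apply: (iffP and5P) => -[? ? /= A B ?]; split => //.
- by move=> m; apply: (implyP (forallP A m)).
- by move=> m; apply: (implyP (forallP B m)).
- by apply/forallP => m; apply/implyP/A.
- by apply/forallP => m; apply/implyP/B.
Qed.

(** Such a box lies left of [j] and below [y], so by [agree] a point of [pi'] in it is also a point
    of [pi]. *)
Lemma box_free_below n (pi pi' : 'S_n) (a j : 'I_n) y x :
    x.1 < 2 -> x.2 < 2 -> a < j -> pi a < y -> pi' a = pi a ->
    (forall m : 'I_n, m < j -> pi' m < y -> pi' m = pi m) ->
  box_free pi a j y x -> box_free pi' a j y x.
Proof.
move=> x1 x2 lt_aj lt_ay pi'a agree; apply: contra => /existsP[m].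
rewrite /inside pi'a => /andP[col row]; apply/existsP; exists m; rewrite col /=.
suff -> : pi m = pi' m by [].
apply/esym/agree.
- by case: x.1 x1 col => [|[|]] //= _; lia.
- by case: x.2 x2 row => [|[|]] //= _; lia.
Qed.

Lemma low_point_eq T n (pi pi' : 'S_n) (a j : 'I_n) y :
    all (fun x => (x.1 < 2) && (x.2 < 2)) T -> pi' a = pi a ->
    (forall m : 'I_n, m < a -> pi' m = pi m) ->
    (forall m : 'I_n, j < m -> pi a < pi' m) ->
    (forall m : 'I_n, m < j -> pi' m < y -> pi' m = pi m) ->
  low_point T pi a j y -> low_point T pi' a j y.
Proof.
move=> T2 pi'a left right agree /low_pointP[aj ay la ra bT].
apply/low_pointP; rewrite pi'a; split => //.
- by move=> m ma; rewrite left //; apply: la.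
- apply/allP => x xT; have /andP[x1 x2] := allP T2 x xT.
  by apply: (box_free_below x1 x2 aj ay pi'a agree); apply: (allP bT).
Qed.

(* For i < j, both swapped values are at least y, the smaller value of the last
   two points: one of j, c differs from d, so its value is below that of i and d.
   The shading of (0, 2) and (0, 3) then forces a < i. *)
Lemma occurs_at_flip_imp asc T n (pi : 'S_n) (i a j : 'I_n) :
    all (fun x => (x.1 < 2) && (x.2 < 2)) T ->
  occurs_at asc T pi a j -> occurs_at (asc (+) (i == j)) T (flip i pi) a j.
Proof.
move=> T2 occ.
case: (pickP (top_pair pi i)) => [d id|no]; last first.
  have -> : flip i pi = pi by rewrite /flip; case: pickP => // c; rewrite no.
  case: eqP => [ij|_]; last by rewrite addbF.
  by case/existsP: occ => c /andP[]; rewrite -ij no.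
rewrite (flip_top_pair id).
case/existsP: occ => c /and3P[jc asc_jc low].
have /low_pointP[aj ay la ra _] := low.
(* The flip at [j] itself keeps the top pair and its minimum and reverses its order. *)
case: (eqVneq i j) => [ij|ne_ij].
  subst i; have dc := top_pair_uniq id jc; subst d.
  have ca : c != a by apply/eqP => ca; subst c; case/top_pairP: jc; lia.
  have ne := @perm_neq_nat _ pi j c; have /top_pairP[lt_jc _] := jc.
  have {}ne := ne (ltac:(by apply: contraTneq lt_jc => ->; rewrite ltnn)).
  apply/existsP; exists c; rewrite top_pair_tperm //=.
  rewrite !permM tpermL tpermR minnC.
  apply/andP; split; first by rewrite addbT -(eqP asc_jc); lia.
  apply: low_point_eq low => //.
  - by rewrite permM tpermD // -(inj_eq val_inj) /=; lia.
  - by move=> m ma; rewrite permM tpermD // -(inj_eq val_inj) /=; lia.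
  - move=> m jm; rewrite permM; case: tpermP => [?|?|_ _]; subst; [lia|lia|exact: ra].
  - by move=> m mj _; rewrite permM tpermD // -(inj_eq val_inj) /=; lia.
rewrite addbF.
have /top_pairP[lt_jc topj] := jc; have /top_pairP[lt_id topi] := id.
have neN (u v : 'I_n) : (u : nat) != v -> u != v by rewrite -(inj_eq val_inj).
(* Here both swapped positions lie right of [j]: the last point moves to [tperm i d c] with its
   value, and positions up to [j] are untouched. *)
case: (ltnP j i) => [ji|].
  have tj (m : 'I_n) : m <= j -> (tperm i d * pi)%g m = pi m.
    by move=> mj; rewrite permM tpermD //; apply: neN; lia.
  have gt_j (m : 'I_n) : j < m -> j < tperm i d m by case: tpermP => // _ _; lia.
  apply/existsP; exists (tperm i d c).
  have E : (tperm i d * pi)%g (tperm i d c) = pi c by rewrite permM tpermK.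
  rewrite E tj // asc_jc /=; apply/andP; split.
    apply/top_pairP; split; first exact: gt_j.
    move=> m jm mc; rewrite E (tj j) // permM; apply: topj; first exact: gt_j.
    by apply: contraNneq mc => <-; rewrite tpermK.
  apply: low_point_eq low => //.
  - by apply: tj; lia.
  - by move=> m ma; apply: tj; lia.
  - by move=> m jm; rewrite permM; apply/ra/gt_j.
  - by move=> m mj _; apply: tj; lia.
rewrite leq_eqVlt => /orP[/eqP/val_inj e|ij]; first by rewrite e eqxx in ne_ij.
set y := minn (pi j) (pi c) in low ay la topj *.
have y_i : y < pi i.
  case: (eqVneq j d) => [jd|/(topi _ ij)]; last by rewrite /y; lia.
  have := topi c; rewrite /y -jd -(inj_eq val_inj) /=; lia.
have y_d : y <= pi d.
  by case: (eqVneq j d) => [jd|/(topi _ ij)]; rewrite /y ?jd; lia.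
have ai : a < i.
  case: (ltngtP a i) => // [/la|/val_inj e]; first by lia.
  by move: ay; rewrite e; lia.
have tD (m : 'I_n) : m != i -> m != d -> (tperm i d * pi)%g m = pi m.
  by move=> mi md; rewrite permM tpermD // eq_sym.
have t_d : (tperm i d * pi)%g d = pi i by rewrite permM tpermR.
have t_i : (tperm i d * pi)%g i = pi d by rewrite permM tpermL.
have ji : j != i by apply: neN; lia.
have ci : c != i by apply: neN; lia.
(* If [d] is [j] or [c], the other of the two has value [y], below both swapped values, so neither
   minimum nor order changes. *)
have [y' asc'] : minn ((tperm i d * pi)%g j) ((tperm i d * pi)%g c) = y
    /\ ((tperm i d * pi)%g j < (tperm i d * pi)%g c) = (pi j < pi c).
  rewrite /y; case: (eqVneq j d) => [jd|jd].
    have cd : c != d by apply: neN; move: lt_jc; rewrite jd; lia.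
    rewrite jd t_d tD //; have := topi c (ltn_trans ij lt_jc) cd; lia.
  case: (eqVneq c d) => [cd|cd]; last by rewrite !tD.
  by rewrite cd t_d tD //; have := topi j ij jd; lia.
apply/existsP; exists c; rewrite asc' asc_jc y' andTb; apply/andP; split.
  apply/top_pairP; split => // m jm mc; rewrite y' tD; first exact: topj.
    by apply: neN; lia.
  by apply/eqP => md; have := topj m jm mc; rewrite md; lia.
apply: low_point_eq low => //.
- by apply: tD; apply: neN; lia.
- by move=> m ma; apply: tD; apply: neN; lia.
- move=> m jm; case: (eqVneq m d) => [->|md]; first by rewrite t_d; lia.
  by rewrite tD //; [apply: ra | apply: neN; lia].
- move=> m _; case: (eqVneq m d) => [->|md]; first by rewrite t_d; lia.
  by case: (eqVneq m i) => [->|mi]; [rewrite t_i; lia | rewrite tD].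
Qed.

(** The converse is the same implication applied to the flipped permutation, as [flip i] is an
    involution. *)
Lemma occurs_at_flip asc T n (pi : 'S_n) (i a j : 'I_n) :
    all (fun x => (x.1 < 2) && (x.2 < 2)) T ->
  occurs_at asc T (flip i pi) a j = occurs_at (asc (+) (i == j)) T pi a j.
Proof.
move=> T2; apply/idP/idP => /(occurs_at_flip_imp i T2).
  by rewrite flipK.
by rewrite -addbA addbb addbF.
Qed.

(** * Composition of all flips *)

Definition flip_all n (pi : 'S_n) : 'S_n := foldr (@flip n) pi (enum 'I_n).

Lemma flip_all_inj n : injective (@flip_all n).
Proof.
rewrite /flip_all => pi pi'.
by elim: (enum 'I_n) => //= i s IHs /(can_inj (flipK i)).
Qed.

Lemma occurs_at_flip_all asc T n (pi : 'S_n) (a j : 'I_n) :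
    all (fun x => (x.1 < 2) && (x.2 < 2)) T ->
  occurs_at asc T (flip_all pi) a j = occurs_at (~~ asc) T pi a j.
Proof.
(* Writing [true] as membership of [j] allows induction over duplicate-free lists: only the flip at
   [j] toggles [asc], and it occurs at most once. *)
move=> T2; rewrite -addbT -[true](mem_enum 'I_n j) /flip_all.
elim: (enum 'I_n) (enum_uniq 'I_n) asc => [|i s IHs] /= => [_|/andP[i_s /IHs{}IHs]] asc.
  by rewrite in_nil addbF.
rewrite occurs_at_flip // IHs inE -addbA; congr (occurs_at (asc (+) _) T pi a j).
rewrite [j == i]eq_sym; by case: eqP => // <-; rewrite (negbTE i_s).
Qed.

(** * Translation of the mesh patterns of length three *)

Definition o0 : 'I_3 := @Ordinal 3 0 isT.
Definition o1 : 'I_3 := @Ordinal 3 1 isT.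
Definition o2 : 'I_3 := @Ordinal 3 2 isT.

Lemma forall_ord3 (P : pred 'I_3) : [forall a, P a] = [&& P o0, P o1 & P o2].
Proof.
apply/forallP/and3P => [all_P | [P0 P1 P2] [[|[|[|//]]] lt_i]]; first by split.
- by rewrite (_ : Ordinal _ = o0) //; apply: val_inj.
- by rewrite (_ : Ordinal _ = o1) //; apply: val_inj.
- by rewrite (_ : Ordinal _ = o2) //; apply: val_inj.
Qed.

Lemma enum_ord3 : enum 'I_3 = [:: o0; o1; o2].
Proof. by apply: (inj_map val_inj); rewrite val_enum_ord. Qed.

Lemma perm132E : (perm132 o0 = o0) * (perm132 o1 = o2) * (perm132 o2 = o1).
Proof.
have E1 : inord 1 = o1 by apply: val_inj; rewrite /= inordK.
have E2 : inord 2 = o2 by apply: val_inj; rewrite /= inordK.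
by rewrite /perm132 E1 E2 tpermL tpermR tpermD.
Qed.

Lemma increasing3 n (f : {ffun 'I_3 -> 'I_n}) :
  increasing f = (f o0 < f o1) && (f o1 < f o2).
Proof. rewrite /increasing !forall_ord3 /=; lia. Qed.

Lemma order_isomorphic123 n (pi : 'S_n) (f : {ffun 'I_3 -> 'I_n}) :
  order_isomorphic perm123 pi f = (pi (f o0) < pi (f o1)) && (pi (f o1) < pi (f o2)).
Proof. rewrite /order_isomorphic !forall_ord3 !perm1 /=; lia. Qed.

Lemma order_isomorphic132 n (pi : 'S_n) (f : {ffun 'I_3 -> 'I_n}) :
  order_isomorphic perm132 pi f = (pi (f o0) < pi (f o2)) && (pi (f o2) < pi (f o1)).
Proof. rewrite /order_isomorphic !forall_ord3 !perm132E /=; lia. Qed.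

Lemma sort3 (x y z : nat) : x < minn y z ->
  sort leq [:: x; y; z] = [:: x; minn y z; maxn y z].
Proof.
move=> lt_x; have -> : sort leq [:: x; y; z] = sort leq [:: x; minn y z; maxn y z].
  apply/perm_sortP; [exact: leq_total | exact: leq_trans | exact: anti_leq |].
  by rewrite perm_cons; case: leqP => // _; rewrite -[[:: z; y]]/(rev [:: y; z]) perm_sym perm_rev.
by apply: sorted_sort; [exact: leq_trans | rewrite /=; lia].
Qed.

Lemma positions3 n (f : {ffun 'I_3 -> 'I_n}) :
  positions f = [:: 0; (f o0).+1; (f o1).+1; (f o2).+1; n.+1].
Proof. by rewrite /positions enum_ord3. Qed.

Lemma values3 n (pi : 'S_n) (f : {ffun 'I_3 -> 'I_n}) :
    pi (f o0) < minn (pi (f o1)) (pi (f o2)) ->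
  values pi f = [:: 0; (pi (f o0)).+1; (minn (pi (f o1)) (pi (f o2))).+1;
                    (maxn (pi (f o1)) (pi (f o2))).+1; n.+1].
Proof. by move=> lt_0; rewrite /values enum_ord3 /= sort3 -?minnSS ?maxnSS //; lia. Qed.

(** The bound matters because [boxes] drops listed pairs outside the diagram. *)
Lemma all_box_empty k n (pi : 'S_n) (f : {ffun 'I_k -> 'I_n}) (s t : seq (nat * nat)) :
    all (fun x => (x.1 < k.+1) && (x.2 < k.+1)) (s ++ t) ->
  [forall x in boxes k s :|: boxes k t, box_empty pi f x] =
  all (region_empty pi (positions f) (values pi f)) (s ++ t).
Proof.
move=> le_k; apply/forall_inP/allP => [empty x x_st | empty x].
  have /andP[x1 x2] := allP le_k x x_st.
  apply: (empty (Ordinal x1, Ordinal x2)).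
  by move: x_st; rewrite mem_cat !inE /= -surjective_pairing.
by rewrite !inE -mem_cat => /empty.
Qed.

Lemma region_emptyE n (pi : 'S_n) (a j c : 'I_n) (y z : nat) x :
    x.1 < 2 -> x.2 < 2 ->
  region_empty pi [:: 0; a.+1; j.+1; c.+1; n.+1] [:: 0; (pi a).+1; y.+1; z.+1; n.+1] x =
  box_free pi a j y x.
Proof. by case: x => [[|[|?]] [|[|?]]]. Qed.

(** For one point [(p, q)]: boxes (0,2), (0,3) give the first condition, (2,0), (3,0) the second,
    and the four boxes with both coordinates at least 2 the third. *)
Lemma notin_boxesE (n p q a j c va y z : nat) :
    a < j -> j < c -> va < y -> y < z -> p < n -> q < n ->
    (p != a -> q != va) -> (p != j -> p != c -> (q != y) && (q != z)) ->
    (p = a -> q = va) -> (p = c -> va < q) ->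
  ~~ has (inside [:: 0; a.+1; j.+1; c.+1; n.+1] [:: 0; va.+1; y.+1; z.+1; n.+1] p q)
    boxesE =
  [&& (p < a) ==> (q < y), (j < p) ==> (va < q) & (j < p) ==> (p != c) ==> (q < y)].
Proof.
move=> aj jc vy yz pn qn qa qjc pa pc.
rewrite /inside /boxesE /= !ltnS pn qn !andbT.
by case: (ltngtP q va) qa qjc pa pc => [qa|qa|->]; case: (ltngtP q y) => qy;
  case: (ltngtP q z) => qz; lia.
Qed.

Lemma region_empty_boxesE n (pi : 'S_n) (a j c : 'I_n) :
    a < j -> j < c -> pi a < minn (pi j) (pi c) ->
  all (region_empty pi [:: 0; a.+1; j.+1; c.+1; n.+1]
         [:: 0; (pi a).+1; (minn (pi j) (pi c)).+1; (maxn (pi j) (pi c)).+1; n.+1]) boxesE =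
  [&& top_pair pi j c, [forall m : 'I_n, (m < a) ==> (pi m < minn (pi j) (pi c))] &
      [forall m : 'I_n, (j < m) ==> (pi a < pi m)]].
Proof.
move=> aj jc ay.
have val_neq (m m' : 'I_n) : (m : nat) != m' -> (pi m : nat) != pi m'.
  by move=> ne; apply: perm_neq_nat; rewrite -(inj_eq val_inj).
have yz : minn (pi j) (pi c) < maxn (pi j) (pi c).
  have := val_neq j c; lia.
have box (m : 'I_n) : _ := notin_boxesE aj jc ay yz (ltn_ord m) (ltn_ord (pi m)) (val_neq m a).
transitivity [forall m : 'I_n, [&& (m < a) ==> (pi m < minn (pi j) (pi c)),
    (j < m) ==> (pi a < pi m) & (j < m) ==> (m != c) ==> (pi m < minn (pi j) (pi c))]].
  rewrite (eq_forallb (P2 := fun m => _) (fun m => esym (box m _ _ _)))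
    => [|m|m /val_inj->|m /val_inj->] //.
  - apply/allP/forallP => [empty m | empty x xE].
      apply/hasPn => x /empty.
      by rewrite /region_empty negb_exists => /forallP; apply.
    by rewrite /region_empty negb_exists; apply/forallP => m; apply: (hasPn (empty m)).
  - move=> mj mc; move: (val_neq m j mj) (val_neq m c mc).
    by case: (leqP (pi j) (pi c)) => _ -> ->.
  - by lia.
rewrite /top_pair jc /=; apply/forallP/and3P => [all_m | [/forallP top /forallP la /forallP ra] m].
  by split; apply/forallP => m; case/and3P: (all_m m).
by rewrite la ra top.
Qed.

Definition pattern (asc : bool) : 'S_3 := if asc then perm123 else perm132.

Lemma occurrence_pattern asc T n (pi : 'S_n) (f : {ffun 'I_3 -> 'I_n}) :
    all (fun x => (x.1 < 2) && (x.2 < 2)) T ->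
  occurrence (MeshPattern (pattern asc) (boxes 3 boxesE :|: boxes 3 T)) pi f =
  [&& top_pair pi (f o1) (f o2), (pi (f o1) < pi (f o2)) == asc &
      low_point T pi (f o0) (f o1) (minn (pi (f o1)) (pi (f o2)))].
Proof.
move=> T2; rewrite /occurrence /= increasing3.
(* The last conjunct serves [asc = false], where a failed strict comparison would allow equality. *)
have -> : order_isomorphic (pattern asc) pi f =
    (pi (f o0) < minn (pi (f o1)) (pi (f o2))) && ((pi (f o1) < pi (f o2)) == asc)
      && (pi (f o1) != pi (f o2)).
  rewrite -(inj_eq val_inj) /=.
  by case: asc; rewrite /= ?order_isomorphic123 ?order_isomorphic132; lia.
rewrite all_box_empty; last first.
  by rewrite all_cat; apply/andP; split => //; apply: sub_all T2 => x; lia.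
case: (boolP (f o0 < f o1)) => [aj|aj]; last by rewrite /low_point (negbTE aj) !andbF.
case: (boolP (f o1 < f o2)) => [jc|jc]; last by rewrite /top_pair (negbTE jc).
case: (boolP (pi (f o0) < minn (pi (f o1)) (pi (f o2)))) => [ay|ay]; last first.
  by rewrite /low_point (negbTE ay) !andbF.
have -> : pi (f o1) != pi (f o2).
  by rewrite (inj_eq perm_inj) -(inj_eq val_inj) /= neq_ltn jc.
rewrite positions3 values3 // all_cat region_empty_boxesE // /low_point aj ay /=.
rewrite (@eq_in_all _ _ (box_free pi (f o0) (f o1) (minn (pi (f o1)) (pi (f o2)))) T); last first.
  by move=> x /(allP T2)/andP[x1 x2]; apply: region_emptyE.
by rewrite andbT; case: (top_pair _ _ _); rewrite ?andbF //= -andbA.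
Qed.

(** The first two positions determine the third by [top_pair_uniq], so occurrences inject into
    pairs. *)
Lemma occurrences_pattern asc T n (pi : 'S_n) :
    all (fun x => (x.1 < 2) && (x.2 < 2)) T ->
  occurrences (MeshPattern (pattern asc) (boxes 3 boxesE :|: boxes 3 T)) pi =
  #|[set aj : 'I_n * 'I_n | occurs_at asc T pi aj.1 aj.2]|.
Proof.
move=> T2; rewrite /occurrences -(card_in_imset (f := fun f : {ffun 'I_3 -> 'I_n} => (f o0, f o1))).
  apply: eq_card => -[a j]; rewrite inE /=; apply/imsetP/existsP => [[f]|[c occ]].
    by rewrite inE occurrence_pattern // => occ [-> ->]; exists (f o2).
  exists [ffun b : 'I_3 => nth a [:: a; j; c] b]; last by rewrite !ffunE.
  by rewrite inE occurrence_pattern // !ffunE.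
move=> f g; rewrite !inE !occurrence_pattern // => /andP[top_f _] /andP[top_g _] [e0 e1].
have e2 : f o2 = g o2 by rewrite e1 in top_f; apply: top_pair_uniq top_f top_g.
have /forallP eq_fg : [forall b, f b == g b] by rewrite forall_ord3 e0 e1 e2 !eqxx.
by apply/ffunP => b; apply/eqP.
Qed.

Theorem theorem4p9 (T : seq (nat * nat))
    (hT : T \in [:: [:: (0, 0)];
                    [:: (0, 1); (1, 0)];
                    [:: (0, 0); (0, 1); (1, 0)];
                    [:: (1, 1)];
                    [:: (0, 0); (1, 1)];
                    [:: (0, 1); (1, 0); (1, 1)];
                    [:: (0, 0); (0, 1); (1, 0); (1, 1)]]) :
  equidistributed
    (MeshPattern perm123 (boxes 3 boxesE :|: boxes 3 T))
    (MeshPattern perm132 (boxes 3 boxesE :|: boxes 3 T)).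
Proof.
have T2 : all (fun x => (x.1 < 2) && (x.2 < 2)) T.
  by move: T hT; apply/allP.
(* The image of the first set under the bijection [flip_all] is shown to be the second; writing [pi]
   as [flip_all (flip_inv pi)] reduces membership to [flip_inv pi]. *)
move=> n l; rewrite -(card_imset _ (@flip_all_inj n)); apply: eq_card => pi.
have [flip_inv _ flipK'] := injF_bij (@flip_all_inj n).
rewrite -[pi]flipK' mem_imset ?inE; last exact: flip_all_inj.
rewrite (occurrences_pattern true) // (occurrences_pattern false) //.
by congr (_ == l); apply: eq_card => -[a j]; rewrite !inE occurs_at_flip_all.
Qed.
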